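(* Suppose $(\Phi_n)_{n=1}^\infty$ is a non-autonomous iterated function system in $\mathbb{R}^d$ with limit set $K$ and associated infinite product space $\Delta$. Then $(\Phi_n)_{n=1}^\infty$ satisfies the bounded neighbourhood condition if and only if the coding map $\pi:\Delta\to K$ (viewed as the relation $\{(x,\pi(x)):x\in\Delta\}\subset\Delta\times K$) is bi-Lipschitz decomposable. In particular, if either of these equivalent conditions holds, then $\dim_{\mathrm A}K=\dim_{\mathrm A}\Delta$.
   Context: **Non-autonomous IFS.** Let $\mathbb{N}=\{1,2,\ldots\}$ and work in Euclidean $\mathbb{R}^d$. For each $n\in\mathbb{N}$ let $\mathcal{J}_n$ be a finite index set with $\#\mathcal{J}_n\ge 2$ and let $\Phi_n=\{S_{n,j}\}_{j\in\mathcal{J}_n}$ be an indexed family of maps $S_{n,j}(x)=r_{n,j}O_{n,j}x+d_{n,j}$ on $\mathbb{R}^d$, where $r_{n,j}\in(0,1)$, $O_{n,j}$ is an orthogonal matrix and $d_{n,j}\in\mathbb{R}^d$. The sequence $(\Phi_n)_{n=1}^\infty$ is a non-autonomous iterated function system (IFS) if there is a non-empty compact set $X\subset\mathbb{R}^d$ with $S_{n,j}(X)\subset X$ for all $n\in\mathbb{N}$, $j\in\mathcal{J}_n$, and $$\lim_{n\to\infty}\sup\{r_{1,j_1}\cdots r_{n,j_n}: j_i\in\mathcal{J}_i,\ i=1,\ldots,n\}=0.$$ Its limit set is the non-empty compact set $$K=\bigcap_{n=1}^\infty\bigcup_{(j_1,\ldots,j_n)\in\mathcal{J}_1\times\cdots\times\mathcal{J}_n}S_{1,j_1}\circ\cdots\circ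 S_{n,j_n}(X).$$ **Symbolic space.** Let $\Delta=\prod_{n=1}^\infty\mathcal{J}_n$. For $n\ge 0$, let $\mathcal{T}_n$ be the set of cylinders $[j_1,\ldots,j_n]=\{j_1\}\times\cdots\times\{j_n\}\times\prod_{k>n}\mathcal{J}_k$ with $j_i\in\mathcal{J}_i$ (so $\mathcal{T}_0=\{\Delta\}$), and $\mathcal{T}=\bigcup_{n\ge 0}\mathcal{T}_n$. For $Q=[j_1,\ldots,j_n]$ put $\rho(Q)=r_{1,j_1}\cdots r_{n,j_n}$ (with $\rho(\Delta)=1$), and if $Q\ne\Delta$ let $\widehat{Q}=[j_1,\ldots,j_{n-1}]$ be its parent. The space $\Delta$ is equipped with the metric $d(x,y)=\inf\{\rho(Q):Q\in\mathcal{T},\ \{x,y\}\subset Q\}$. For $r>0$ let $\mathcal{T}(r)=\{Q\in\mathcal{T}\setminus\{\Delta\}:\rho(Q)\le r<\rho(\widehat{Q})\}$. The coding map $\pi$ is defined by $\{\pi((i_n)_{n=1}^\infty)\}=\bigcap_{n=1}^\infty S_{1,i_1}\circ\cdots\circ S_{n,i_n}(X)$; it satisfies $\pi(\Delta)=K$. **Bounded neighbourhood condition.** For $x\in K$ and $r>0$, let $\mathcal{N}(x,r)=\{Q\in\mathcal{T}(r):\pi(Q)\cap B(x,r)\ne\varnothing\}$, where $B(x,r)$ is the closed ball. The IFS satisfies the bounded neighbourhood condition if $\limsup_{r\to0}\sup_{x\in K}\#\mathcal{N}(x,r)<\infty$. **Lipschitz decomposable relations.** Let $Z,Y$ be non-empty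 metric spaces and $\mathcal{R}\subset Z\times Y$ a relation. Its domain is $\{z\in Z:(\{z\}\times Y)\cap\mathcal{R}\ne\varnothing\}$, the image of $A\subset Z$ is $\mathcal{R}(A)=\{y\in Y:(A\times\{y\})\cap\mathcal{R}\ne\varnothing\}$, and $\mathcal{R}^{-1}=\{(y,z):(z,y)\in\mathcal{R}\}\subset Y\times Z$. $\mathcal{R}$ is Lipschitz decomposable if its domain is $Z$ and there are constants $M\in\mathbb{N}$ and $c>0$ such that for all $z\in Z$ and $r>0$ there are $y_1,\ldots,y_M\in Y$ with $\mathcal{R}(B(z,r))\subset\bigcup_{i=1}^M B(y_i,cr)$ (closed balls). $\mathcal{R}$ is bi-Lipschitz decomposable if both $\mathcal{R}$ and $\mathcal{R}^{-1}$ are Lipschitz decomposable. **Assouad dimension.** For $Z=K$ or $Z=\Delta$, $\dim_{\mathrm A}Z$ is the infimum of all $s$ for which there is $C>0$ such that for all $0<r\le R<1$ and all $x\in Z$, $N_r(B(x,R)\cap Z)\le C(R/r)^s$, where $N_r(A)$ is the least number of closed balls of radius $r$ needed to cover $A$. *)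

(* Defs.v *)
From HB Require Import structures.
From mathcomp Require Import all_boot all_order all_algebra.
From mathcomp Require Import all_classical all_reals all_analysis.
From mathcomp Require Import ring.

Set Implicit Arguments.
Unset Strict Implicit.
Unset Printing Implicit Defensive.

Import Order.TTheory GRing.Theory Num.Theory.
Import numFieldNormedType.Exports.

Local Open Scope classical_set_scope.
Local Open Scope ring_scope.

Section metric_notions.
Context {R : realType}.
Implicit Types T Z Y : metricType R.

(* Not [closed_ball], which is the closure of the open ball: the two differ in
   the ultrametric symbolic space. *)
Definition cball T (x : T) (r : R) : set T := [set y | mdist x y <= r].

(* +oo when no finite cover exists *)
Definition covering_number T (A : set T) (r : R) : \bar R :=
  ereal_inf [set n%:R%:E | n in
    [set n : nat | exists c : 'I_n -> T, A `<=` \bigcup_i cball (c i) r]].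

Definition assouad_dim T (A : set T) : \bar R :=
  ereal_inf [set s%:E | s in [set s : R | exists2 C : R, 0 < C &
    forall (x : T) (r r' : R), A x -> 0 < r -> r <= r' -> r' < 1 ->
      (covering_number (cball x r' `&` A) r <= (C * (r' / r) `^ s)%:E)%E]].

Definition rel_image Z Y (rel : set (Z * Y)) (A : set Z) : set Y :=
  [set y | exists2 z, A z & rel (z, y)].

Definition lipschitz_decomposable Z Y (rel : set (Z * Y)) : Prop :=
  rel.`1 = [set: Z] /\
  exists (M : nat) (c : R), [/\ (0 < M)%N, 0 < c &
    forall (z : Z) (r : R), 0 < r -> exists y : 'I_M -> Y,
      rel_image rel (cball z r) `<=` \bigcup_i cball (y i) (c * r)].

Definition bilipschitz_decomposable Z Y (rel : set (Z * Y)) : Prop :=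
  lipschitz_decomposable rel /\ lipschitz_decomposable (rel^-1)%relation.

End metric_notions.

(* Column vectors with the Euclidean metric; the metric that the library puts
   on ['cV[R]_d] itself comes from the sup norm. *)
Definition euclidean (R : realType) (d : nat) : Type := 'cV[R]_d.

Section euclidean_metric.
Context {R : realType} {d : nat}.
Implicit Types x y z : 'cV[R]_d.

Definition eucl_norm x : R := Num.sqrt (\sum_i x i ord0 ^+ 2).

Lemma eucl_norm_triangle x y : eucl_norm (x + y) <= eucl_norm x + eucl_norm y.
Proof.
have sq0 (u : 'cV[R]_d) : 0 <= \sum_i u i ord0 ^+ 2.
  by apply: sumr_ge0 => i _; exact: sqr_ge0.
set a := \sum_i x i ord0 ^+ 2; set b := \sum_i y i ord0 ^+ 2.
set c := \sum_i x i ord0 * y i ord0.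
have cs : c ^+ 2 <= a * b.
  have : 0 <= \sum_i \sum_j (x i ord0 * y j ord0 - x j ord0 * y i ord0) ^+ 2.
    by apply: sumr_ge0 => i _; apply: sumr_ge0 => j _; exact: sqr_ge0.
  rewrite (_ : \sum_i _ = (a * b - c ^+ 2) *+ 2) ?pmulrn_lge0 ?subr_ge0//.
  transitivity (a * b - c * c *+ 2 + b * a); last first.
    by rewrite (mulrC b) expr2 addrAC -mulr2n mulrnBl.
  rewrite /a /b /c !big_distrlr/= -sumrMnl -sumrB -big_split/=.
  apply: eq_bigr => i _; rewrite -sumrMnl -sumrB -big_split/=.
  apply: eq_bigr => j _.
  rewrite !expr2; ring.
rewrite -(@ler_pXn2r _ 2)// ?nnegrE ?addr_ge0 ?sqrtr_ge0//.
rewrite sqrrD !sqr_sqrtr// -/a -/b.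
have -> : \sum_i (x + y) i ord0 ^+ 2 = a + c *+ 2 + b.
  rewrite /a /b /c -sumrMnl -!big_split/=; apply: eq_bigr => i _.
  by rewrite mxE sqrrD.
rewrite lerD2r lerD2l lerMn2r/= (le_trans (ler_norm _))//.
by rewrite -sqrtr_sqr -sqrtrM// ler_sqrt// mulr_ge0 ?sq0.
Qed.

Definition eucl_dist (x y : euclidean R d) : R := eucl_norm ((x : 'cV[R]_d) - y).

Lemma eucl_distxx x : eucl_dist x x = 0.
Proof.
by rewrite /eucl_dist/eucl_norm subrr big1 ?sqrtr0// => i _; rewrite mxE expr0n.
Qed.

Lemma eucl_dist_positivity x y : eucl_dist x y = 0 -> x = y.
Proof.
move=> /eqP; rewrite sqrtr_eq0 => s0; apply/eqP; rewrite -subr_eq0.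
have sq i : 0 <= (x - y) i ord0 ^+ 2 by exact: sqr_ge0.
have /eqP : \sum_i (x - y) i ord0 ^+ 2 == 0.
  by rewrite eq_le s0 sumr_ge0.
move=> /psumr_eq0P h; apply/eqP/matrixP => i j.
rewrite (ord1 j) [RHS]mxE; apply/eqP; rewrite -sqrf_eq0; apply/eqP.
exact: h.
Qed.

Lemma eucl_dist_sym x y : eucl_dist x y = eucl_dist y x.
Proof.
rewrite /eucl_dist/eucl_norm; congr (Num.sqrt _); apply: eq_bigr => i _.
by rewrite !mxE -sqrrN opprB.
Qed.

Lemma eucl_dist_triangle y x z : eucl_dist x z <= eucl_dist x y + eucl_dist y z.
Proof. by rewrite /eucl_dist -(subrKA y) eucl_norm_triangle. Qed.

HB.instance Definition _ := Choice.copy (euclidean R d) 'cV[R]_d.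
HB.instance Definition _ := isMetric.Build R (euclidean R d)
  eucl_distxx eucl_dist_positivity eucl_dist_sym eucl_dist_triangle.

End euclidean_metric.

(* Sequences are indexed from 0 rather than from 1. *)
Record similarities (R : realType) (d : nat) := Similarities {
  alphabet : nat -> finType ;
  contraction : forall n, alphabet n -> R ;
  orth : forall n, alphabet n -> 'M[R]_d ;
  translation : forall n, alphabet n -> 'cV[R]_d ;
  card_alphabet : forall n, (2 <= #|alphabet n|)%N ;
  contraction_itv : forall n (j : alphabet n), 0 < contraction j < 1 ;
  orth_orthogonal : forall n (j : alphabet n), orth j *m (orth j)^T = 1%:M
}.

Definition symbolic_space R d (S : similarities R d) : Type :=
  forall n, alphabet S n.

Section symbolic.
Context {R : realType} {d : nat} {S : similarities R d}.

HB.instance Definition _ := gen_eqMixin (symbolic_space S).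
HB.instance Definition _ := gen_choiceMixin (symbolic_space S).

Definition simmap n (j : alphabet S n) (x : euclidean R d) : euclidean R d :=
  contraction j *: (orth j *m x) + translation j.

Fixpoint simmap_comp (i : symbolic_space S) (n : nat) :
    euclidean R d -> euclidean R d :=
  if n is m.+1 then simmap_comp i m \o simmap (i m) else id.

(* Every finite word extends to a point of the symbolic space, so cylinders of
   level n are the sets [cylinder i n].  As the index sets have at least two
   elements, the set [cylinder i n] determines n and the first n entries of i,
   so [rho i n] and the parent [cylinder i n.-1] depend on that set only. *)
Definition cylinder (i : symbolic_space S) (n : nat) : set (symbolic_space S) :=
  [set x | forall k, (k < n)%N -> x k = i k].

Definition rho (i : symbolic_space S) (n : nat) : R :=
  \prod_(k < n) contraction (i k).

Definition stopping (r : R) : set (set (symbolic_space S)) :=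
  [set Q | exists (i : symbolic_space S) (n : nat),
    [/\ Q = cylinder i n.+1, rho i n.+1 <= r & r < rho i n]].

Definition common_rho (x y : symbolic_space S) : set R :=
  [set s | exists (i : symbolic_space S) (n : nat),
    [/\ cylinder i n x, cylinder i n y & s = rho i n]].

Definition sdist (x y : symbolic_space S) : R := inf (common_rho x y).

End symbolic.

Record nonautonomous_ifs (R : realType) (d : nat) := NonautonomousIFS {
  ifs_maps :> similarities R d ;
  seed : set (euclidean R d) ;
  seed_nonempty : seed !=set0 ;
  seed_compact : compact seed ;
  seed_invariant : forall n (j : alphabet ifs_maps n),
    simmap j @` seed `<=` seed ;
  rho_cvg0 : (fun n => sup [set rho i n | i in [set: symbolic_space ifs_maps]])
    @ \oo --> (0 : R)
}.

Section symbolic_metric.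
Context {R : realType} {d : nat} (Phi : nonautonomous_ifs R d).
Implicit Types i x y z : symbolic_space Phi.

Lemma eq_rho i x n : cylinder i n x -> rho x n = rho i n.
Proof. by move=> h; apply: eq_bigr => k _; rewrite h. Qed.

Lemma rho_gt0 i n : 0 < rho i n.
Proof. by apply: prodr_gt0 => k _; case/andP: (contraction_itv (i k)). Qed.

Lemma rhoS i n : rho i n.+1 <= rho i n.
Proof.
rewrite /rho big_ord_recr/= ler_piMr ?(ltW (rho_gt0 i n))//.
by case/andP: (contraction_itv (i n)) => _ /ltW.
Qed.

Lemma rho_le i m n : (m <= n)%N -> rho i n <= rho i m.
Proof.
elim: n => [|n IH]; first by case: m.
rewrite leq_eqVlt => /predU1P[->//|/IH]; exact: le_trans (rhoS i n).
Qed.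

Lemma rho_le1 i n : rho i n <= 1.
Proof. by rewrite (le_trans (rho_le i (leq0n n)))// /rho big_ord0. Qed.

Lemma common_rho_lb x y : lbound (common_rho x y) 0.
Proof. by move=> _ [i [n [_ _ ->]]]; exact/ltW/rho_gt0. Qed.

Lemma common_rho_inf x y : has_inf (common_rho x y).
Proof.
by split; [exists (rho x 0), x, 0%N|exists 0; exact: common_rho_lb].
Qed.

Lemma sdist_le x y i n : cylinder i n x -> cylinder i n y ->
  sdist x y <= rho i n.
Proof.
move=> ix iy; apply: ge_inf; last by exists i, n.
by exists 0; exact: common_rho_lb.
Qed.

Lemma sdist_ge0 x y : 0 <= sdist x y.
Proof.
by apply: lb_le_inf (@common_rho_lb x y); case: (common_rho_inf x y).
Qed.

Lemma sdistxx x : sdist x x = 0.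
Proof.
apply/eqP; rewrite eq_le sdist_ge0 andbT; apply/ler_addgt0Pl => e e0.
rewrite addr0; have /cvgrPdist_lt/(_ e e0)[n _ /(_ n (leqnn n))] := rho_cvg0 Phi.
rewrite sub0r normrN => h.
rewrite (le_trans (@sdist_le x x x n _ _))// ltW// (le_lt_trans _ h)//.
rewrite (le_trans _ (ler_norm _))//; apply: ub_le_sup; last by exists x.
by exists 1 => _ [i _ <-]; exact: rho_le1.
Qed.

Lemma sdist_positivity x y : sdist x y = 0 -> x = y.
Proof.
move=> xy0; apply: functional_extensionality_dep => k.
apply/eqP; apply/negPn/negP => xyk.
have : rho x k <= sdist x y.
  apply: lb_le_inf; first by case: (common_rho_inf x y).
  move=> _ [i [n [ix iy ->]]]; rewrite -(eq_rho ix); apply: rho_le.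
  by rewrite leqNgt; apply/negP => kn; move: xyk; rewrite ix// iy// eqxx.
by rewrite xy0 leNgt rho_gt0.
Qed.

Lemma sdist_sym x y : sdist x y = sdist y x.
Proof.
by rewrite /sdist; congr inf; apply/seteqP; split => s [i [n [? ? ?]]];
  exists i, n.
Qed.

Lemma sdist_triangle y x z : sdist x z <= sdist x y + sdist y z.
Proof.
apply/ler_addgt0Pr => e e0.
have e20 : 0 < e / 2 by rewrite divr_gt0.
have [_ [i [m [ix iy ->]]] im] := inf_adherent e20 (common_rho_inf x y).
have [_ [j [n [jy jz ->]]] jn] := inf_adherent e20 (common_rho_inf y z).
rewrite [e]splitr addrACA (le_trans _ (ltW (ltrD im jn)))//.
rewrite -(eq_rho iy) -(eq_rho jy).
have [mn|/ltnW nm] := leqP m n.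
- apply: (@le_trans _ _ (rho y m)); last by rewrite lerDl ltW ?rho_gt0.
  apply: sdist_le => k km; first by rewrite ix// iy.
  by rewrite jz ?jy// (leq_trans km).
- apply: (@le_trans _ _ (rho y n)); last by rewrite lerDr ltW ?rho_gt0.
  apply: sdist_le => k kn; last by rewrite jz// jy.
  by rewrite ix ?iy// (leq_trans kn).
Qed.

HB.instance Definition _ := isMetric.Build R (symbolic_space Phi)
  sdistxx sdist_positivity sdist_sym sdist_triangle.

End symbolic_metric.

Section limit_set.
Context {R : realType} {d : nat} (Phi : nonautonomous_ifs R d).

Definition limit_set : set (euclidean R d) :=
  \bigcap_n \bigcup_(i : symbolic_space Phi) simmap_comp i n.+1 @` seed Phi.

Definition limit_space : Type := set_type limit_set.

HB.instance Definition _ := Choice.copy limit_space (set_type limit_set).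

Definition ldist (x y : limit_space) : R := mdist (val x) (val y).

Lemma ldistxx x : ldist x x = 0. Proof. exact: mdistxx. Qed.

Lemma ldist_positivity x y : ldist x y = 0 -> x = y.
Proof. by move=> /mdist_positivity/val_inj. Qed.

Lemma ldist_sym x y : ldist x y = ldist y x. Proof. exact: metric_sym. Qed.

Lemma ldist_triangle y x z : ldist x z <= ldist x y + ldist y z.
Proof. exact: metric_triangle. Qed.

HB.instance Definition _ := isMetric.Build R limit_space
  ldistxx ldist_positivity ldist_sym ldist_triangle.

(* The intersection is a singleton, so the default value 0 is never used. *)
Definition coding (i : symbolic_space Phi) : euclidean R d :=
  xget (0 : 'cV[R]_d) (\bigcap_n simmap_comp i n.+1 @` seed Phi).

Definition coding_relation : set (symbolic_space Phi * limit_space) :=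
  [set p | coding p.1 = val p.2].

Definition neighbours (x : euclidean R d) (r : R) :
    set (set (symbolic_space Phi)) :=
  [set Q | stopping r Q /\ (coding @` Q) `&` cball x r !=set0].

(* [counting] is the cardinality, +oo for infinite sets. *)
Definition bounded_neighbourhood_condition : Prop :=
  (limf_esup (fun r : R => ereal_sup
     [set (counting (neighbours x r) : \bar R) | x in limit_set]) 0^'+ < +oo)%E.

End limit_set.

Arguments coding_relation {R d} Phi _.

(* Main.v *)
(* The coding map pi is always Lipschitz, so only its inverse relation matters.
   That pi^-1(B(x, r)) is covered by boundedly many balls of radius c r follows
   from the bounded neighbourhood condition because the elements of T(r) have
   diameter at most r; for r bounded away from 0 one ball suffices once c is
   large, as Delta has diameter at most 1.  Conversely, a closed ball of radius r
   in Delta meets at most one element of T(r), and the constant c is absorbed by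
   covering B(x, r) with boundedly many balls of radius r / c, which is possible
   in a Euclidean space.  Finally, covers of balls can be transported in both
   directions along a bi-Lipschitz decomposable relation, at the cost of
   constants only, so the two spaces have the same Assouad exponents. *)
Require Import Defs.
From mathcomp Require Import all_boot all_order all_algebra.
From mathcomp Require Import all_classical all_reals all_analysis.
From mathcomp Require Import finmap ring lra.

Set Implicit Arguments.
Unset Strict Implicit.
Unset Printing Implicit Defensive.

Import Order.TTheory GRing.Theory Num.Theory.
Import numFieldNormedType.Exports.

Local Open Scope classical_set_scope.
Local Open Scope ring_scope.

(** * Finite covers by balls *)

Section covers.
Context {R : realType}.
Implicit Types T U : metricType R.

(** Centres are confined to [D] because covering bounds are often available only for balls centred
    in the set under study. A list may be shorter than [N], so the empty set is covered even when no
    centre is at hand. *)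
Definition ncover T (D A : set T) (r : R) (N : nat) : Prop :=
  exists s : seq T, [/\ (size s <= N)%N, {in s, forall c, D c} &
    forall a, A a -> exists2 c, c \in s & mdist c a <= r].

Lemma ncoverW T (D D' A A' : set T) r r' N N' :
  D `<=` D' -> A' `<=` A -> r <= r' -> (N <= N')%N ->
  ncover D A r N -> ncover D' A' r' N'.
Proof.
move=> DD' AA' rr' NN' [s [sN sD sA]]; exists s; split.
- exact: leq_trans sN NN'.
- by move=> c /sD/DD'.
- by move=> a /AA'/sA[c cs ca]; exists c => //; exact: le_trans rr'.
Qed.

Lemma ncover0 T (D : set T) r N : ncover D set0 r N.
Proof. by exists [::]; split. Qed.

Lemma ncover1 T (D A : set T) x r : D x -> A `<=` cball x r -> ncover D A r 1.
Proof.
move=> Dx Ax; exists [:: x]; split => //.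
  by move=> c; rewrite inE => /eqP ->.
by move=> a /Ax xa; exists x; rewrite ?inE.
Qed.

Lemma ncover_bigcup T (I : eqType) (s : seq I) (F : I -> set T)
    (D A : set T) r M N :
  (size s <= M)%N -> {in s, forall i, ncover D (F i) r N} ->
  A `<=` [set a | exists2 i, i \in s & F i a] -> ncover D A r (M * N).
Proof.
move=> sM sF AF.
suff : ncover D [set a | exists2 i, i \in s & F i a] r (size s * N).
  by apply: ncoverW => //; rewrite leq_mul2r sM orbT.
elim: s {sM AF} sF => [|i s IH] sF.
  by apply: ncoverW (ncover0 D r 0) => // a [].
have [t [tN tD tF]] := sF i (mem_head _ _).
have [|u [uN uD uF]] := IH; first by move=> j js; apply: sF; rewrite inE js orbT.
exists (t ++ u); split.
- by rewrite size_cat mulSn leq_add.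
- by move=> c; rewrite mem_cat => /orP[/tD|/uD].
- move=> a [j]; rewrite inE => /predU1P[->/tF[c ct ca]|js ja].
    by exists c; rewrite ?mem_cat ?ct.
  by have [|c cu ca] := uF a; [exists j|exists c; rewrite ?mem_cat ?cu ?orbT].
Qed.

Lemma covering_number_le T (A : set T) r n :
  ncover setT A r n -> (covering_number A r <= n%:R%:E)%E.
Proof.
move=> [s [sn _ sA]]; apply: (@le_trans _ _ (size s)%:R%:E).
  apply: ereal_inf_lbound; exists (size s) => //=.
  exists (tnth (in_tuple s)) => a /sA[c cs ca].
  by have /tnthP[i ci] := cs : c \in in_tuple s; exists i; rewrite // -ci.
by rewrite lee_fin ler_nat.
Qed.

(** Passing to [x + 1] makes the inequality strict, so an actual cover lies below the bound and
    attainment of the infimum need not be discussed. *)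
Lemma ncover_of_covering_number T (A : set T) r (x : R) :
  (covering_number A r <= x%:E)%E ->
  exists2 n : nat, n%:R <= x + 1 & ncover setT A r n.
Proof.
move=> Ax; have /ereal_inf_lt : (covering_number A r < (x + 1)%:E)%E.
  by rewrite (le_lt_trans Ax)// lte_fin ltrDl.
move=> [_ [n [c Ac] <-]]; rewrite lte_fin => nx.
exists n; first exact: ltW.
exists [seq c i | i : 'I_n]; split => //.
  by rewrite size_map -cardT card_ord.
by move=> a /Ac[i _ ia]; exists (c i) => //; apply: map_f; rewrite mem_enum.
Qed.

Lemma lipschitz_decomposable_ncover T U (rel : set (T * U)) :
  lipschitz_decomposable rel -> exists (M : nat) (c : R), 0 < c /\
    forall z r, 0 < r -> ncover setT (rel_image rel (cball z r)) (c * r) M.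
Proof.
move=> [_ [M [c [_ c0 h]]]]; exists M, c; split => // z r /(h z)[y hy].
exists [seq y i | i : 'I_M]; split => //.
  by rewrite size_map -cardT card_ord.
by move=> a /hy[i _ ia]; exists (y i) => //; apply: map_f; rewrite mem_enum.
Qed.

Lemma ncover_lipschitz_decomposable T U (rel : set (T * U)) (u0 : U) M c :
  rel.`1 = setT -> 0 < c ->
  (forall z r, 0 < r -> ncover setT (rel_image rel (cball z r)) (c * r) M) ->
  lipschitz_decomposable rel.
Proof.
move=> relT c0 h; split => //; exists M.+1, c; split => // z r /(h z).
(* One ball is added to make their number positive; indices beyond the list give the default centre
   [u0]. *)
move=> [s [sM _ sA]]; exists (fun i => nth u0 s i) => u /sA[y ys yu].
have iM : (index y s < M.+1)%N by rewrite ltnS (leq_trans _ sM)// ltnW ?index_mem.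
by exists (Ordinal iM); rewrite //= nth_index.
Qed.

(** * Assouad exponents and their transfer along a relation *)

Definition assouad_exponent T (A : set T) (s : R) : Prop :=
  exists2 C : R, 0 < C &
    forall (x : T) (r r' : R), A x -> 0 < r -> r <= r' -> r' < 1 ->
      (covering_number (cball x r' `&` A) r <= (C * (r' / r) `^ s)%:E)%E.

Lemma assouad_dim_eq T U (A : set T) (B : set U) :
  (forall s, assouad_exponent A s <-> assouad_exponent B s) ->
  assouad_dim A = assouad_dim B.
Proof.
move=> AB; rewrite /assouad_dim; congr ereal_inf; congr image.
by apply/seteqP; split => s /AB.
Qed.

(** For negative [s] the bound falls below 1 once [r' / r] is large, although a ball containing its
    centre needs at least one covering ball. The ratio [t] is chosen so that the bound equals
    [C / (C + 1)]. *)
Lemma assouad_exponent_ge0 T (A : set T) s :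
  A !=set0 -> assouad_exponent A s -> 0 <= s.
Proof.
move=> [x Ax] [C C0 hC]; rewrite leNgt; apply/negP => s0.
have C1 : 1 <= C + 1 by rewrite lerDr ltW.
pose t := (C + 1) `^ (- s^-1).
have t1 : 1 <= t.
  have -> : 1 = 1 `^ (- s^-1) :> R by rewrite powR1.
  by rewrite ge0_ler_powR ?nnegrE// ?oppr_ge0 ?invr_le0 ?ltW// (lt_le_trans _ C1).
have ts : t `^ s = (C + 1)^-1.
  by rewrite -powRrM mulNr mulVf ?lt_eqF// powR_inv1// (le_trans _ C1).
have t0 : 0 < t by rewrite (lt_le_trans _ t1).
have h0 : 0 < (2%:R^-1 : R) by rewrite invr_gt0.
have := hC x (2^-1 / t) 2^-1 Ax (divr_gt0 h0 t0).
have ht : 2%:R^-1 / t <= (2%:R^-1 : R) by rewrite ler_pdivrMr// ler_peMr// ltW.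
have h1 : (2%:R^-1 : R) < 1 by rewrite invf_lt1 ?ltr1n.
move=> /(_ ht h1).
rewrite invf_div mulrCA divff ?gt_eqF// mulr1 ts.
apply/negP; rewrite -ltNge (@lt_le_trans _ _ 1%:E)//.
  by rewrite lte_fin ltr_pdivrMr ?mul1r ?ltrDl// addr_gt0.
apply: le_ereal_inf_tmp => _ [n [c Ac] <-]; rewrite lee_fin ler1n.
case: n c Ac => // c /(_ x)[|[]//].
by split => //; rewrite /cball/= mdistxx ltW.
Qed.

(* For [r' >= 1], outside the range of the definition of the Assouad dimension,
   one starts from the finite cover of [A] by balls of radius [r0 < 1]. *)
Lemma assouad_exponent_ncover T (A : set T) s r0 m :
  A !=set0 -> 0 < r0 < 1 -> ncover A A r0 m -> assouad_exponent A s ->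
  exists2 C : R, 0 < C & forall x r r', A x -> 0 < r -> r <= r' ->
    exists2 N : nat, N%:R <= C * (r' / r) `^ s &
      ncover setT (cball x r' `&` A) r N.
Proof.
move=> A0 /andP[r00 r01] [S [Sm SA AS]] As.
have s0 := assouad_exponent_ge0 A0 As; have [C C0 hC] := As.
(* Non-negativity of [s] makes the power at least 1, which absorbs the additive 1 of
   [ncover_of_covering_number] into the constant [C + 1]. *)
have pow1 r r' : 0 < r -> r <= r' -> 1 <= (r' / r) `^ s.
  move=> r_0 rr'; rewrite -(powRr0 (r' / r)) ler_powR//.
  by rewrite ler_pdivlMr ?mul1r.
have small x r r' : A x -> 0 < r -> r <= r' -> r' < 1 ->
    exists2 N : nat, N%:R <= (C + 1) * (r' / r) `^ s &
      ncover setT (cball x r' `&` A) r N.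
  move=> Ax r_0 rr' r'1.
  have [N NC hN] := ncover_of_covering_number (hC x r r' Ax r_0 rr' r'1).
  by exists N => //; rewrite (le_trans NC)// mulrDl lerD2l mul1r pow1.
exists (m.+1%:R * (C + 1)); first by rewrite mulr_gt0// addr_gt0.
move=> x r r' Ax r_0 rr'; have [r'1|r'1] := ltP r' 1.
  have [N NC hN] := small _ _ _ Ax r_0 rr' r'1; exists N => //.
  by rewrite (le_trans NC)// -mulrA ler_peMl ?ler1n// (le_trans _ NC).
have [rr0|r0r] := leP r r0; last first.
  exists m.
    rewrite -[X in X <= _]mulr1 ler_pM ?pow1//.
    by rewrite -[X in X <= _]mulr1 ler_pM ?ler_nat// lerDr ltW.
  exists S; split => // a [_ /AS[c cS ca]]; exists c => //.
  by rewrite (le_trans ca)// ltW.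
(* Now [r <= r0 < 1 <= r']: each of the [m] balls of radius [r0] is covered separately by at most
   [N] balls of radius [r]. *)
pose N := Num.truncn ((C + 1) * (r0 / r) `^ s).
have C10 : 0 <= (C + 1) * (r0 / r) `^ s.
  by rewrite mulr_ge0 ?powR_ge0// addr_ge0// ltW.
exists (m * N)%N.
  rewrite natrM -mulrA ler_pM// ?ler_nat//.
  rewrite (le_trans (_ : _ <= (C + 1) * (r0 / r) `^ s))//.
    by rewrite /N truncn_le.
  rewrite ler_pM2l ?addr_gt0// ge0_ler_powR ?nnegrE ?divr_ge0 ?(ltW r00) ?(ltW r_0)//.
    by rewrite (le_trans _ r'1).
  by rewrite ler_pM2r ?invr_gt0// (le_trans (ltW r01)).
apply: (@ncover_bigcup _ _ S (fun c => cball c r0 `&` A)) => //.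
  move=> c cS; have [n nC hn] := small _ _ _ (SA _ cS) r_0 rr0 r01.
  by apply: ncoverW hn => //; rewrite /N truncn_ge_nat.
by move=> a [_ Aa]; have [c cS ca] := AS _ Aa; exists c.
Qed.

(** A ball of radius [r'] in [B] is pulled back to [M] balls of radius [c * r'] centred in [A]; each
    is covered by [N] balls of radius [r / c'], whose images are covered by [M'] balls of radius
    [r]. As [c * r'] may exceed 1, the extension to large radii is used, hence the finite cover of
    [A]. *)
Lemma assouad_exponent_transfer T U (A : set T) (B : set U)
    (rel : T -> U -> Prop) (s r0 c c' : R) (m M M' : nat) :
  B !=set0 -> 0 < r0 < 1 -> ncover A A r0 m ->
  (forall a b, rel a b -> A a) -> (forall b, B b -> exists a, rel a b) ->
  0 < c -> (forall b r, B b -> 0 < r ->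
    ncover A [set a | exists2 b', cball b r b' & rel a b'] (c * r) M) ->
  0 < c' -> (forall a r, 0 < r ->
    ncover setT [set b | exists2 a', cball a r a' & rel a' b] (c' * r) M') ->
  assouad_exponent A s -> assouad_exponent B s.
Proof.
move=> B0 r01 Am relA relB.
(* Having both constants at least 1 ensures [r / c' <= c * r']. *)
wlog c1 : c / 1 <= c => [wlg c0 hc|].
  apply: (wlg (Num.max c 1)); first by rewrite le_max lexx orbT.
    by rewrite lt_max c0.
  move=> b r Bb r_0; apply: ncoverW (hc b r Bb r_0) => //.
  by rewrite ler_pM2r// le_max lexx.
move=> c0 hc.
wlog c'1 : c' / 1 <= c' => [wlg c'0 hc'|].
  apply: (wlg (Num.max c' 1)); first by rewrite le_max lexx orbT.
    by rewrite lt_max c'0.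
  move=> b r r_0; apply: ncoverW (hc' b r r_0) => //.
  by rewrite ler_pM2r// le_max lexx.
move=> c'0 hc' As.
have A0 : A !=set0 by case: B0 => b /relB[a /relA]; exists a.
have [C C0 hC] := assouad_exponent_ncover A0 r01 Am As.
exists (M.+1%:R * (M'.+1%:R * (C * (c * c') `^ s))).
  by rewrite !mulr_gt0// powR_gt0// mulr_gt0.
move=> b r r' Bb r_0 rr' r'1.
have r'0 : 0 < r' by exact: lt_le_trans rr'.
have rc0 : 0 < r / c' by rewrite divr_gt0.
pose x := C * (c * r' / (r / c')) `^ s.
have x0 : 0 <= x by rewrite mulr_ge0 ?powR_ge0// ltW.
pose N := Num.truncn x.
apply: (@le_trans _ _ (M * (N * M'))%:R%:E).
  apply: covering_number_le.
  have [S [SM SA hS]] := hc b r' Bb r'0.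
  apply: (@ncover_bigcup _ _ S (fun a =>
    [set b | exists2 a', rel a' b & cball a (c * r') a'])) => //; last first.
    move=> b' [bb' Bb']; have [a ab'] := relB b' Bb'.
    have [|a' a'S a'a] := hS a; first by exists b'.
    by exists a' => //; exists a.
  move=> a aS.
  have rcr : r / c' <= c * r'.
    by rewrite ler_pdivrMr// (le_trans rr')// mulrAC ler_peMl ?(ltW r'0)// mulr_ege1.
  have [n nx [S' [S'n _ hS']]] := hC a (r / c') (c * r') (SA _ aS) rc0 rcr.
  have nN : (n <= N)%N by rewrite /N truncn_ge_nat.
  apply: (@ncover_bigcup _ _ S' (fun a =>
    [set b | exists2 a', cball a (r / c') a' & rel a' b])).
  - exact: leq_trans S'n nN.
  - by move=> a' _; have := hc' a' _ rc0; rewrite mulrCA divff ?mulr1// gt_eqF.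
  - move=> b' [a' a'b' aa']; have [|a'' a''S' h] := hS' a'.
      by split => //; exact: relA a'b'.
    by exists a'' => //; exists a'.
have powE : x = C * (c * c') `^ s * (r' / r) `^ s.
  rewrite /x -[RHS]mulrA -powRM ?mulr_ge0 ?divr_ge0 ?invr_ge0//;
    rewrite ?(ltW r'0) ?(ltW r_0) ?(ltW c0) ?(ltW c'0)//.
  by congr (_ * _ `^ _); rewrite invf_div mulrACA.
rewrite lee_fin -[leRHS]mulrA -[X in _ <= _ * X]mulrA -powE natrM ler_pM ?ler_nat//.
by rewrite natrM mulrC ler_pM ?ler_nat// truncn_le.
Qed.

End covers.

(** * Bounded sets, the doubling property and similarities in Euclidean space *)

Lemma compact_mdist_bounded {R : realType} (T : metricType R) (A : set T) :
  compact A -> exists2 D : R, 0 < D & forall x y, A x -> A y -> mdist x y <= D.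
Proof.
have [->|/set0P[x0 Ax0]] := eqVneq A set0; first by exists 1.
move=> cA; have cd : continuous (mdist x0 : T -> R^o).
  move=> x; apply/cvgrPdist_lt => e e0; apply/nbhs_ballP; exists e => //= y.
  rewrite ballEmdist /= => xy; apply: le_lt_trans xy.
  have := metric_triangle x0 y x; rewrite (metric_sym y x).
  have := metric_triangle x0 x y => xy yx.
  by rewrite ler_norml; apply/andP; split; lra.
have /compact_bounded[M [_ hM]] : compact ((mdist x0 : T -> R^o) @` A).
  by apply: continuous_compact => //; exact: continuous_subspaceT.
pose D := `|M| + 1.
have MD : M < D by rewrite (le_lt_trans (ler_norm M))// ltrDl.
have hD x : A x -> mdist x0 x <= D.
  move=> Ax; apply: le_trans (ler_norm _) _.
  by apply: (hM D MD); exists x.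
exists (D + D) => [|x y Ax Ay]; first by rewrite addr_gt0// /D ltr_wpDl.
by rewrite (le_trans (metric_triangle _ x0 _))// lerD ?hD// metric_sym hD.
Qed.

(** One centre is picked in each fibre of [f] that meets [A], so the centres lie in [A] itself. *)
Lemma ncover_fibers {R : realType} (T : metricType R) (I : finType) (f : T -> I)
    (A : set T) (r : R) :
  (forall y y', A y -> A y' -> f y = f y' -> mdist y y' <= r) ->
  ncover A A r #|I|.
Proof.
move=> fr; rewrite -[X in ncover _ _ _ X]muln1.
apply: (@ncover_bigcup _ _ _ (enum I) (fun i => [set y | A y /\ f y = i])).
- by rewrite cardE.
- move=> i _; have [->|/set0P[y [Ay yi]]] := eqVneq [set y | A y /\ f y = i] set0.
    exact: ncover0.
  by apply: (ncover1 Ay) => y' [Ay' y'i]; apply: fr => //; rewrite yi.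
- by move=> y Ay; exists (f y); rewrite ?mem_enum.
Qed.

Section euclidean_lemmas.
Context {R : realType} {d : nat}.
Implicit Types x y : euclidean R d.

Lemma coord_le_mdist x y (i : 'I_d) : `|x i ord0 - y i ord0| <= mdist x y.
Proof.
rewrite -sqrtr_sqr; apply: ler_wsqrtr.
rewrite (bigD1 i)//= !mxE lerDl; apply: sumr_ge0 => j _; exact: sqr_ge0.
Qed.

Lemma mdist_le_coord x y (e : R) : 0 <= e ->
  (forall i, `|x i ord0 - y i ord0| <= e) -> mdist x y <= d%:R * e.
Proof.
move=> e0 xy; rewrite -[leRHS]ger0_norm ?mulr_ge0// -sqrtr_sqr; apply: ler_wsqrtr.
apply: (@le_trans _ _ (\sum_(i < d) e ^+ 2)).
  apply: ler_sum => i _; rewrite !mxE -real_normK ?num_real//.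
  by rewrite lerXn2r ?nnegrE.
rewrite sumr_const card_ord exprMn -[leLHS]mulr_natl ler_wpM2r ?sqr_ge0//.
by rewrite -natrX ler_nat -mulnn; case: (posnP d) => [->//|]; exact: leq_pmull.
Qed.

(** The cube around the ball is cut into cells of side [h]; two points of one cell are at distance
    at most [d%:R * h <= k * r]. The number of cells depends only on [k] and [d]. *)
Lemma euclidean_doubling (k : R) : 0 < k -> exists N : nat,
  forall (A : set (euclidean R d)) x r, 0 < r ->
    ncover A (cball x r `&` A) (k * r) N.
Proof.
(* The cube has side [2 * r], that is [2 * d.+1%:R / k] times [h]; [d.+1] avoids a division by zero
   when [d] is 0. *)
move=> k0; pose L := Num.truncn (2 * d.+1%:R / k).
exists #|{ffun 'I_d -> 'I_L.+1}| => A x r r0.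
pose h := k * r / d.+1%:R.
have h0 : 0 < h by rewrite divr_gt0// mulr_gt0.
pose q y i := (y i ord0 - x i ord0 + r) / h.
pose f y : {ffun 'I_d -> 'I_L.+1} := [ffun i => inord (Num.truncn (q y i))].
apply: (@ncoverW _ _ (cball x r `&` A) _ (cball x r `&` A)
  _ (k * r) _ #|{ffun 'I_d -> 'I_L.+1}|) => //.
have q0 y i : cball x r y -> 0 <= q y i.
  move=> xy; rewrite divr_ge0 ?(ltW h0)// -lerBlDr sub0r.
  have := le_trans (coord_le_mdist x y i) xy.
  by rewrite distrC ler_norml => /andP[].
have qL y i : cball x r y -> (Num.truncn (q y i) <= L)%N.
  move=> xy; apply: le_truncn; rewrite /q /h ler_pdivrMr//.
  have -> : 2 * d.+1%:R / k * (k * r / d.+1%:R) = r + r.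
    by field; rewrite nat1r pnatr_eq0/= gt_eqF.
  rewrite lerD2r; have := le_trans (coord_le_mdist x y i) xy.
  by rewrite distrC ler_norml => /andP[].
apply: (@ncover_fibers _ _ _ f) => y y' [xy _] [xy' _] /ffunP fyy'.
apply: (@le_trans _ _ (d%:R * h)); last first.
  by rewrite /h mulrCA ler_piMr ?mulr_ge0 ?ltW// ltr_pdivrMr// mul1r ltr_nat.
apply: mdist_le_coord => [|i]; first exact: ltW.
have := fyy' i; rewrite !ffunE => /(congr1 val)/=.
rewrite !inordK ?ltnS ?qL// => tt.
have := truncn_itv (q0 y i xy); rewrite tt => /andP[a1 a2].
have := truncn_itv (q0 y' i xy') => /andP[b1 b2].
have qq : `|q y i - q y' i| <= 1.
  move: a1 a2 b1 b2; rewrite -!natr1 => a1 a2 b1 b2.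
  by rewrite ler_norml; apply/andP; split; lra.
have -> : y i ord0 - y' i ord0 = (q y i - q y' i) * h.
  by rewrite -mulrBl divfK ?gt_eqF//; ring.
by rewrite normrM (gtr0_norm h0) ler_piMl// ltW.
Qed.

Lemma eucl_normZ (a : R) (x : 'cV[R]_d) : eucl_norm (a *: x) = `|a| * eucl_norm x.
Proof.
rewrite /eucl_norm -sqrtr_sqr -sqrtrM ?sqr_ge0//; congr Num.sqrt.
by rewrite mulr_sumr; apply: eq_bigr => i _; rewrite mxE exprMn.
Qed.

Lemma eucl_norm_orth (O : 'M[R]_d) (x : 'cV[R]_d) :
  O *m O^T = 1%:M -> eucl_norm (O *m x) = eucl_norm x.
Proof.
have sqE (y : 'cV[R]_d) : \sum_i y i ord0 ^+ 2 = (y^T *m y) ord0 ord0.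
  by rewrite mxE; apply: eq_bigr => i _; rewrite mxE expr2.
move=> /mulmx1C OO; rewrite /eucl_norm !sqE trmx_mul -mulmxA (mulmxA O^T).
by rewrite OO mul1mx.
Qed.

End euclidean_lemmas.

(** * The coding map: well-definedness, Lipschitz bound and surjectivity *)

Section coding.
Context {R : realType} {d : nat} (Phi : nonautonomous_ifs R d).
Implicit Types i j : symbolic_space Phi.

Lemma mdist_simmap n (a : alphabet Phi n) (x y : euclidean R d) :
  mdist (simmap a x) (simmap a y) = Defs.contraction a * mdist x y.
Proof.
rewrite /mdist/= /eucl_dist.
have -> : (simmap a x : 'cV[R]_d) - simmap a y =
    Defs.contraction a *: (orth a *m ((x : 'cV[R]_d) - y)).
  by rewrite /simmap opprD addrACA subrr addr0 mulmxBr scalerBr.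
rewrite eucl_normZ.
rewrite eucl_norm_orth ?orth_orthogonal// ger0_norm//.
by case/andP: (contraction_itv a) => /ltW.
Qed.

Lemma mdist_simmap_comp i n (x y : euclidean R d) :
  mdist (simmap_comp i n x) (simmap_comp i n y) = rho i n * mdist x y.
Proof.
elim: n x y => [|n IH] x y /=; first by rewrite /rho big_ord0 mul1r.
by rewrite IH mdist_simmap mulrA /rho big_ord_recr.
Qed.

Lemma eq_simmap_comp i j n : cylinder i n j -> simmap_comp j n = simmap_comp i n.
Proof.
elim: n => //= n IH h; rewrite h ?IH// => k kn; apply: h.
by rewrite ltnS ltnW.
Qed.

Lemma simmap_comp_seedS i n :
  simmap_comp i n.+1 @` seed Phi `<=` simmap_comp i n @` seed Phi.
Proof.
move=> _ [x sx <-] /=; exists (simmap (i n) x) => //.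
by apply: seed_invariant; exists x.
Qed.

Lemma simmap_comp_seed_le i m n : (m <= n)%N ->
  simmap_comp i n @` seed Phi `<=` simmap_comp i m @` seed Phi.
Proof.
elim: n => [|n IH]; first by rewrite leqn0 => /eqP ->.
rewrite leq_eqVlt => /predU1P[->//|/IH]; apply: subset_trans.
exact: simmap_comp_seedS.
Qed.

Lemma rho_lt i (e : R) : 0 < e -> exists n, rho i n < e.
Proof.
move=> e0; have [_ [j [n [ji _ ->]]]] := inf_adherent e0 (common_rho_inf i i).
by rewrite -[inf _]/(sdist i i) sdistxx add0r -(eq_rho ji) => ?; exists n.
Qed.

Lemma simmap_comp_continuous i n : continuous (simmap_comp i n).
Proof.
move=> x V /nbhs_ballP[e /= e0 eV]; apply/nbhs_ballP; exists e => //= y.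
rewrite ballEmdist /= => xy; apply: eV; rewrite ballEmdist /= mdist_simmap_comp.
by rewrite (le_lt_trans _ xy)// ler_piMl ?mdist_ge0// rho_le1.
Qed.

Lemma seed_bounded : exists2 D : R, 0 < D &
  forall x y, seed Phi x -> seed Phi y -> mdist x y <= D.
Proof. exact/compact_mdist_bounded/seed_compact. Qed.

(** The default value in [coding] is never taken: the images of the seed along [i] are nested,
    non-empty and compact, so they have a common point. *)
Lemma codingP i n : (simmap_comp i n @` seed Phi) (coding i).
Proof.
suff /xgetPex : exists y : 'cV[R]_d, (\bigcap_n simmap_comp i n.+1 @` seed Phi) y.
  by move=> /(_ 0) h; apply: (@simmap_comp_seed_le _ _ n.+1) => //; exact: h.
have closed_im m : closed (simmap_comp i m @` seed Phi).
  apply: compact_closed; first exact: metric_hausdorff.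
  apply: continuous_compact; last exact: seed_compact.
  exact/continuous_subspaceT/simmap_comp_continuous.
have [x0 sx0] := seed_nonempty Phi.
have in_im m n' : (m <= n')%N -> (simmap_comp i m @` seed Phi) (simmap_comp i n' x0).
  by move=> /(@simmap_comp_seed_le i); apply; exists x0.
(* The sequence is eventually in each of the closed images, so a cluster point lies in all of
   them. *)
pose F := (fun m => simmap_comp i m x0) @ \oo.
have FF : ProperFilter F by exact: fmap_proper_filter.
have [y [_ Fy]] : seed Phi `&` cluster F !=set0.
  apply: seed_compact; exists 0%N => //= m _.
  by have [x sx /= <-] := in_im 0%N m (leq0n m).
exists y => m _; apply: closed_im => V yV.
by apply: Fy yV; exists m.+1 => //= m'; exact: in_im.
Qed.

(** On a common cylinder both codes lie in one copy of the seed scaled by [rho], so [D] can be any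
    bound on the diameter of the seed; then the infimum over common cylinders is taken. *)
Lemma mdist_coding : exists2 D : R, 0 < D &
  forall i j, mdist (coding i) (coding j) <= D * mdist i j.
Proof.
have [D D0 hD] := seed_bounded; exists D => // i j; rewrite mulrC -ler_pdivrMr//.
apply: lb_le_inf; first by case: (common_rho_inf i j).
move=> _ [k [n [ki kj ->]]]; rewrite ler_pdivrMr//.
have [x sx <-] := codingP i n; have [y sy <-] := codingP j n.
rewrite (eq_simmap_comp ki) (eq_simmap_comp kj) mdist_simmap_comp.
by rewrite ler_pM2l ?rho_gt0// hD.
Qed.

Lemma coding_limit_set i : limit_set Phi (coding i).
Proof. by move=> n _; exists i => //; exact: codingP. Qed.

Lemma symbolic_space_nonempty : [set: symbolic_space Phi] !=set0.
Proof.
have h n : exists a : alphabet Phi n, True.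
  have : (0 < #|alphabet Phi n|)%N by rewrite (leq_trans _ (card_alphabet Phi n)).
  by move=> /card_gt0P[a _]; exists a.
by exists (fun n => projT1 (cid (h n))).
Qed.

(* König's lemma for the tree of words w with x in S_w(X) *)
Lemma coding_surj (x : euclidean R d) : limit_set Phi x -> exists i, coding i = x.
Proof.
move=> Kx.
(* The first [n] letters of [i] form a node with infinitely many descendants: at every level [m]
   some continuation still has [x] in its image. *)
pose E n i := forall m, exists2 j, cylinder i n j & (simmap_comp j m @` seed Phi) x.
have E0 i : E 0%N i.
  move=> m; have [j _ h] := Kx m I; exists j => //.
  exact: simmap_comp_seedS.
have ES n i : E n i -> exists2 i', cylinder i n i' & E n.+1 i'.
  move=> Ei; apply: contrapT => h.
  have {}h (a : alphabet Phi n) : exists m, forall j, cylinder i n j -> j n = a ->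
      ~ (simmap_comp j m @` seed Phi) x.
    apply: contrapT => ha; apply: h.
    have {}ha m : exists j, [/\ cylinder i n j, j n = a & (simmap_comp j m @` seed Phi) x].
      apply: contrapT => hm; apply: ha; exists m => j ij ja jx.
      by apply: hm; exists j.
    have [i' [ii' i'a _]] := ha 0%N; exists i' => // m.
    have [j [ij ja jx]] := ha m; exists j => // k.
    by rewrite ltnS leq_eqVlt => /predU1P[->|kn]; [rewrite ja|rewrite ij// ii'].
  (* If every letter [a] fails at some level, all fail at the maximum of these levels, since the
     alphabet is finite and the images are nested. *)
  have [j ij jx] := Ei (\max_a projT1 (cid (h a))).
  apply: (projT2 (cid (h (j n))) j ij erefl).
  by apply: simmap_comp_seed_le jx; exact: leq_bigmax.
pose step n (p : {i | E n i}) : {i | E n.+1 i} :=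
  exist _ _ (s2valP' (cid2 (ES n (sval p) (svalP p)))).
have [i0 _] := symbolic_space_nonempty.
pose w := fix w n : {i | E n i} :=
  if n is m.+1 then step m (w m) else exist _ i0 (E0 i0).
(* The diagonal word: [w n.+1] keeps the first [n] letters of [w n], so entry [n] is final from
   [w n.+1] on. *)
pose i : symbolic_space Phi := fun n => sval (w n.+1) n.
have wS n k : (k < n)%N -> sval (w n.+1) k = sval (w n) k.
  by move=> kn; rewrite /= (s2valP (cid2 (ES n (sval (w n)) (svalP (w n))))).
have iw n : cylinder (sval (w n)) n i.
  move=> k; elim: n => // n IH; rewrite ltnS leq_eqVlt => /predU1P[->//|kn].
  by rewrite wS// IH.
exists i; have [D D0 hD] := seed_bounded.
apply: mdist_positivity; apply/eqP; rewrite eq_le mdist_ge0 andbT.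
apply/ler_addgt0Pl => e e0; rewrite addr0.
have [n ne] := rho_lt i (divr_gt0 e0 D0).
have [y sy <-] := codingP i n.
have [j wj [z sz <-]] := svalP (w n) n.
have /eq_simmap_comp -> : cylinder i n j by move=> k kn; rewrite wj// (iw n)//.
rewrite mdist_simmap_comp; apply: (@le_trans _ _ (rho i n * D)).
  by rewrite ler_pM2l ?rho_gt0// hD.
by rewrite -ler_pdivlMr// ltW.
Qed.

End coding.

(** * Stopping cylinders and the bounded neighbourhood condition *)

Lemma counting_le {R : realType} (T : choiceType) (A : set T) (s : seq T) :
  (forall a, A a -> a \in s) -> (counting A <= (size s)%:R%:E :> \bar R)%E.
Proof.
move=> As; have fA : finite_set A.
  by apply: (@sub_finite_set _ _ [set` s]); [move=> a /As|exact: finite_seq].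
rewrite /counting asboolT// lee_fin ler_nat.
by apply: uniq_leq_size => // a; rewrite in_fset_set// in_setE => /As.
Qed.

Lemma counting_seq {R : realType} (T : choiceType) (A : set T) (M : nat) :
  (counting A <= M%:R%:E :> \bar R)%E ->
  exists2 s : seq T, (size s <= M)%N & forall a, A a -> a \in s.
Proof.
rewrite /counting; case: asboolP => // fA; rewrite lee_fin ler_nat => AM.
exists (enum_fset (fset_set A)) => // a Aa.
by rewrite in_fset_set// in_setE.
Qed.

Section coding_covers.
Context {R : realType} {d : nat} (Phi : nonautonomous_ifs R d).
Implicit Types i j y : symbolic_space Phi.
Implicit Types Q : set (symbolic_space Phi).

Lemma stopping_cylinder r Q y : stopping r Q -> Q y ->
  exists n, [/\ Q = cylinder y n.+1, rho y n.+1 <= r & r < rho y n].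
Proof.
move=> [i [n [-> ir ri]]] iy; exists n; split.
- by apply/seteqP; split => x hx k kn; rewrite hx// iy.
- by rewrite (eq_rho iy).
- by rewrite (@eq_rho _ _ _ i)// => k kn; apply: iy; exact: ltnW.
Qed.

(** Along [y] the values of [rho] do not increase, so they cross the threshold [r] at a single
    level. *)
Lemma stopping_uniq r Q Q' y :
  stopping r Q -> stopping r Q' -> Q y -> Q' y -> Q = Q'.
Proof.
move=> rQ rQ' /(stopping_cylinder rQ)[n [-> nr rn]].
move=> /(stopping_cylinder rQ')[m [-> mr rm]]; congr (cylinder y _.+1).
apply/eqP; rewrite eqn_leq; apply/andP; split; rewrite leqNgt; apply/negP => lt.
  by have := lt_le_trans rn (le_trans (rho_le y lt) mr); rewrite ltxx.
by have := lt_le_trans rm (le_trans (rho_le y lt) nr); rewrite ltxx.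
Qed.

Lemma stopping_exists r y : 0 < r < 1 -> exists2 Q, stopping r Q & Q y.
Proof.
move=> /andP[r0 r1].
have : exists n, rho y n <= r by have [n /ltW] := rho_lt y r0; exists n.
(* The least level with [rho y n <= r] is not 0, because [rho y 0 = 1 > r]. *)
case/ex_minnP => -[|n] nr hn.
  by move: nr; rewrite /rho big_ord0 leNgt r1.
exists (cylinder y n.+1) => //; exists y, n; split => //.
by rewrite ltNge; apply/negP => /hn; rewrite ltnn.
Qed.

Lemma stopping_mdist r Q y i : stopping r Q -> Q y -> Q i -> mdist y i <= r.
Proof.
move=> rQ /(stopping_cylinder rQ)[n [-> nr _]] yi.
exact: le_trans (sdist_le _ yi) nr.
Qed.

(* With [stopping_uniq]: a closed ball of radius [r] meets at most one element
   of [stopping r], namely the one containing its centre. *)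
Lemma stopping_cball r Q i y : stopping r Q -> Q i -> mdist y i <= r -> Q y.
Proof.
move=> rQ Qi yi; have [n [-> nr rn]] := stopping_cylinder rQ Qi.
(* As the distance is below [rho i n], some common cylinder has [rho] below it too; its length
   exceeds [n], so [y] and [i] agree on the first [n.+1] letters. *)
have yin : 0 < rho i n - mdist y i by rewrite subr_gt0 (le_lt_trans yi).
have [_ [j [m [jy ji ->]]]] := inf_adherent yin (common_rho_inf y i).
rewrite subrKC -(eq_rho ji) => rmn.
have nm : (n < m)%N by rewrite ltnNge; apply: contraL rmn => /(rho_le i); rewrite -leNgt.
move=> k kn; have km := leq_trans kn nm.
by rewrite jy// ji.
Qed.

(** The form that Lipschitz decomposability of the inverse relation takes once surjectivity of
    [coding] has settled its domain. *)
Definition coding_preimages_covered : Prop :=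
  exists (M : nat) (c : R), 0 < c /\
    forall (x : euclidean R d) (r : R), limit_set Phi x -> 0 < r ->
      ncover setT (@coding R d Phi @^-1` cball x r) (c * r) M.

Definition coding_point i : limit_space Phi :=
  exist _ (coding i) (mem_set (coding_limit_set i)).

Lemma coding_lipschitz_decomposable : lipschitz_decomposable (coding_relation Phi).
Proof.
have [D D0 hD] := mdist_coding Phi.
have [i0 _] := symbolic_space_nonempty Phi.
apply: (@ncover_lipschitz_decomposable _ _ _ _ (coding_point i0) 1 D) => //.
  by apply/seteqP; split => // i _; exists (coding_point i).
move=> i r r0; apply: (@ncover1 _ _ _ _ (coding_point i)) => // z [j ij jz].
rewrite /cball /= [mdist _ _]/(mdist (coding i) (val z)).
have <- : coding j = val z := jz.
by rewrite (le_trans (hD i j))// ler_pM2l.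
Qed.

Lemma inverse_lipschitz_decomposableP :
  lipschitz_decomposable ((coding_relation Phi)^-1)%relation <->
  coding_preimages_covered.
Proof.
split=> [/lipschitz_decomposable_ncover[M [c [c0 h]]]|[M [c [c0 h]]]].
  exists M, c; split => // x r Kx r0.
  pose z : limit_space Phi := exist _ x (mem_set Kx).
  apply: ncoverW (h z r r0) => // i xi.
  by exists (coding_point i).
have [i0 _] := symbolic_space_nonempty Phi.
apply: (@ncover_lipschitz_decomposable _ _ _ _ i0 M c) => //.
  apply/seteqP; split => // z _.
  by have [i iz] := coding_surj (set_mem (valP z)); exists i.
move=> z r r0; apply: ncoverW (h (val z) r (set_mem (valP z)) r0) => //.
move=> i [z' zz' iz']; rewrite /preimage /=.
by have -> : coding i = val z' := iz'.
Qed.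

(** An upper limit below [+oo] provides a right neighbourhood of 0 on which the suprema are bounded,
    and the bound is rounded up to a natural number. *)
Lemma bounded_neighbourhoodP : bounded_neighbourhood_condition Phi <->
  exists (M : nat) (r0 : R), 0 < r0 /\
    forall (x : euclidean R d) (r : R), limit_set Phi x -> 0 < r -> r < r0 ->
      (counting (neighbours (Phi := Phi) x r) <= M%:R%:E :> \bar R)%E.
Proof.
rewrite /bounded_neighbourhood_condition; set f := (fun r : R => _); split.
  move=> /ereal_inf_lt[_ [V V0 <-]] supV.
  have [M hM] : exists M : nat, (ereal_sup (f @` V) <= M%:R%:E)%E.
    case: ereal_sup supV => [x| |] // _; last by exists 0%N; rewrite leNye.
    by exists (Num.truncn x).+1; rewrite lee_fin; exact/ltW/truncnS_gt.
  move/nbhs_right0P/nbhs_ballP : V0 => [e /= e0 eV].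
  exists M, e; split => // x r Kx r_0 re; apply: le_trans hM.
  apply: (@le_trans _ _ (f r)); first by apply: ereal_sup_ubound; exists x.
  apply: ereal_sup_ubound; exists r => //.
  by rewrite -[r]add0r; apply: eV => //; rewrite /ball/= sub0r normrN gtr0_norm.
move=> [M [r0 [r0_gt0 h]]].
apply: (@le_lt_trans _ _ M%:R%:E); last exact: ltry.
apply: (@le_trans _ _ (ereal_sup (f @` [set r | 0 < r /\ r < r0]))).
  apply: ereal_inf_lbound; exists [set r | 0 < r /\ r < r0] => //.
  by apply: filterS2 (nbhs_right_gt 0) (nbhs_right_lt r0_gt0) => r /= ? ?; split.
apply: ge_ereal_sup => _ [r [r_0 rr0] <-].
by apply: ge_ereal_sup => _ [x Kx <-]; exact: h.
Qed.

Lemma bounded_neighbourhood_covered :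
  bounded_neighbourhood_condition Phi <-> coding_preimages_covered.
Proof.
apply: (iff_trans bounded_neighbourhoodP); split.
  move=> [M [r0 [r0_gt0 h]]].
  have [i0 _] := symbolic_space_nonempty Phi.
  (* If [r >= r0] or [r >= 1], then [c * r >= 1], which is at least the diameter of the symbolic
     space, and one ball suffices. *)
  pose c := Num.max 1 r0^-1.
  exists M.+1, c; split; first by rewrite lt_max ltr01.
  move=> x r Kx r_gt0; have [rr0|] := boolP ((r < r0) && (r < 1)); last first.
    move=> rr0; apply: (@ncoverW _ _ setT _ setT _ 1 _ 1) => //.
      move: rr0; rewrite negb_and -!leNgt => /orP[rr0|r1].
        rewrite -(mulVf (lt0r_neq0 r0_gt0)).
        by rewrite ler_pM ?invr_ge0 ?(ltW r0_gt0)// le_max lexx orbT.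
      by rewrite mulr_ege1// le_max lexx.
    apply: (@ncover1 _ _ _ _ i0) => // i _.
    by rewrite /cball/= (le_trans (@sdist_le _ _ _ _ _ i0 0 _ _))// /rho big_ord0.
  move/andP: rr0 => [rr0 r1].
  have [s sM hs] := counting_seq (h x r Kx r_gt0 rr0).
  rewrite -(muln1 M.+1).
  (* The list [s] may also contain sets outside [stopping r]; the condition inside the piece makes
     these contribute nothing. *)
  apply: (@ncover_bigcup _ _ _ s (fun Q => [set i | stopping r Q /\ Q i])).
  - exact: leqW.
  - move=> Q _.
    have [->|/set0P[y [rQ Qy]]] := eqVneq [set i | stopping r Q /\ Q i] set0.
      exact: ncover0.
    apply: (@ncover1 _ _ _ _ y) => // i [_ Qi].
    apply: le_trans (stopping_mdist rQ Qy Qi) _.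
    by rewrite ler_peMl ?(ltW r_gt0)// le_max lexx.
  - move=> i xi; have [|Q rQ Qi] := @stopping_exists r i; first by rewrite r_gt0.
    exists Q => //; apply: hs; split => //.
    by exists (coding i); split => //; exists i.
move=> [M [c [c0 h]]].
have ci0 : 0 < c^-1 by rewrite invr_gt0.
(* Radius [c^-1 * r] in the limit set becomes radius exactly [r] for the preimages, as
   [stopping_cball] requires. *)
have [N hN] := @euclidean_doubling R d _ ci0.
exists (N * M)%N, 1; split => // x r Kx r_gt0 _.
have : ncover setT (@coding R d Phi @^-1` cball x r) r (N * M).
  have [s [sN sK hs]] := hN (limit_set Phi) x r r_gt0.
  apply: (@ncover_bigcup _ _ _ s
    (fun z => @coding R d Phi @^-1` cball z (c^-1 * r))) => //.
    move=> z zs; have := h z (c^-1 * r) (sK _ zs).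
    by rewrite mulrA divff ?gt_eqF// mul1r; apply; rewrite mulr_gt0.
  move=> i xi; have [|z zs zi] := hs (coding i).
    by split => //; exact: coding_limit_set.
  by exists z.
move=> [s [sNM _ hs]].
(* Every neighbour contains one of the [N * M] centres, so by [stopping_uniq] it is the value of [Q]
   there; the default [set0] cannot occur at such a centre. *)
pose Q y := xget set0 [set Q | stopping r Q /\ Q y].
apply: (@le_trans _ _ (size (map Q s))%:R%:E); last first.
  by rewrite lee_fin ler_nat size_map.
apply: counting_le => Q' [rQ' [_ [[i Q'i <-] xi]]].
have [y ys yi] := hs i xi; have Q'y := stopping_cball rQ' Q'i yi.
suff -> : Q' = Q y by exact: map_f.
have [rQ Qy] : [set Q | stopping r Q /\ Q y] (Q y) by apply: xgetPex; exists Q'.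
exact: stopping_uniq rQ' rQ Q'y Qy.
Qed.

(** * Comparison of the Assouad exponents of the limit set and the symbolic space *)

Lemma limit_set_nonempty : limit_set Phi !=set0.
Proof.
by have [i _] := symbolic_space_nonempty Phi; exists (coding i); exact: coding_limit_set.
Qed.

(** The symbolic space has diameter at most 1, so the limit set lies in one ball of radius [D];
    doubling with factor [2^-1 / D] brings the radius down to one half. *)
Lemma limit_set_totally_bounded : exists m,
  ncover (limit_set Phi) (limit_set Phi) (2^-1 : R) m.
Proof.
have [D D0 hD] := mdist_coding Phi.
have k0 : 0 < 2^-1 / D by rewrite divr_gt0.
have [m hm] := @euclidean_doubling R d _ k0.
have [i _] := symbolic_space_nonempty Phi.
exists m; have := hm (limit_set Phi) (coding i) D D0.
rewrite divfK ?gt_eqF//; apply: ncoverW => // x Kx; split => //.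
have [j <-] := coding_surj Kx.
apply: le_trans (hD i j) _; rewrite ger_pMr//.
by rewrite (le_trans (@sdist_le _ _ _ _ _ i 0 _ _))// /rho big_ord0.
Qed.

Lemma symbolic_space_totally_bounded : exists (r0 : R) m,
  0 < r0 < 1 /\ ncover [set: symbolic_space Phi] setT r0 m.
Proof.
have [i0 _] := symbolic_space_nonempty Phi.
(* The first-level cylinders have diameter at most the largest first contraction ratio, which is
   below 1 as the alphabet is finite; starting the maximum at one half keeps [r0] in the open unit
   interval. *)
pose r0 : R := \big[Num.max/2^-1]_(a : alphabet Phi 0%N) Defs.contraction a.
have h0 : 0 < (2^-1 : R) by rewrite invr_gt0.
exists r0, #|alphabet Phi 0%N|; split.
  apply/andP; split.
    apply: lt_le_trans h0 _; exact: bigmax_ge_id.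
  apply/bigmax_ltP; split; first by rewrite invf_lt1 ?ltr1n.
  by move=> a _; case/andP: (contraction_itv a).
apply: (@ncover_fibers _ _ _ (fun i : symbolic_space Phi => i 0%N)) => i j _ _ ij.
apply: (@le_trans _ _ (rho i 1)).
  by apply: sdist_le => // -[|//] _.
rewrite /rho big_ord1; exact: le_bigmax.
Qed.

Lemma assouad_exponent_coding s : coding_preimages_covered ->
  assouad_exponent (limit_set Phi) s <-> assouad_exponent [set: symbolic_space Phi] s.
Proof.
move=> [M [c [c0 h]]]; have [D D0 hD] := mdist_coding Phi.
split.
  have [m hm] := limit_set_totally_bounded.
  apply: (@assouad_exponent_transfer _ _ _ _ _
    (fun x i => coding i = x) _ 2^-1 D (2 * c) m 1 M) => //.
  - exact: symbolic_space_nonempty.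
  - by rewrite invr_gt0 invf_lt1 ?ltr1n// ltr0n.
  - by move=> _ i <-; exact: coding_limit_set.
  - by move=> i _; exists (coding i).
  - move=> i r _ r0; apply: (@ncover1 _ _ _ _ (coding i)).
      exact: coding_limit_set.
    move=> _ [j ij <-]; apply: le_trans (hD i j) _.
    by rewrite ler_pM2l.
  - by rewrite mulr_gt0.
  move=> x r r0.
  (* The centre [x] is an arbitrary point of Euclidean space, while [h] needs a centre in the limit
     set: a coded point of the ball replaces it and the radius doubles, whence the constant
     [2 * c]. *)
  have [[i xi]|xN] := pselect (exists i : symbolic_space Phi,
    cball x r (coding i)); last first.
    by exists [::]; split => // i [z xz iz]; case: xN; exists i; rewrite iz.
  have r20 : 0 < 2 * r by rewrite mulr_gt0.
  apply: ncoverW (h _ _ (coding_limit_set i) r20) => //; last by rewrite mulrCA mulrA.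
  move=> j [z xz jz].
  rewrite /preimage /cball /= jz (le_trans (metric_triangle _ x _))//.
  by rewrite mulrDl mul1r lerD// metric_sym.
have [r0 [m [r01 hm]]] := symbolic_space_totally_bounded.
apply: (@assouad_exponent_transfer _ _ _ _ _
  (fun i x => coding i = x) _ r0 c D m M 1) => //.
- exact: limit_set_nonempty.
- by move=> x /coding_surj.
- move=> x r Kx r_0; apply: ncoverW (h x r Kx r_0) => // i [z xz iz].
  by rewrite /preimage /mkset iz.
- move=> i r r_0; apply: (@ncover1 _ _ _ _ (coding i)) => // _ [j ij <-].
  apply: le_trans (hD i j) _.
  by rewrite ler_pM2l.
Qed.

End coding_covers.

Theorem proposition2p5 (R : realType) (d : nat) (Phi : nonautonomous_ifs R d) :
  (bounded_neighbourhood_condition Phi <->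
     bilipschitz_decomposable (coding_relation Phi)) /\
  (bounded_neighbourhood_condition Phi \/
     bilipschitz_decomposable (coding_relation Phi) ->
   assouad_dim (limit_set Phi) = assouad_dim [set: symbolic_space Phi]).
Proof.
have BNC : bounded_neighbourhood_condition Phi <->
    bilipschitz_decomposable (coding_relation Phi).
  apply: (iff_trans (bounded_neighbourhood_covered Phi)).
  apply: (iff_trans (iff_sym (inverse_lipschitz_decomposableP Phi))).
  by split => [h|[]//]; split => //; exact: coding_lipschitz_decomposable.
split => // h; have /bounded_neighbourhood_covered hc : bounded_neighbourhood_condition Phi.
  by case: h => // /BNC.
by apply: assouad_dim_eq => s; exact: assouad_exponent_coding.
Qed.
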